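(* There exists an absolute constant $\epsilon_0>0$ such that for any $0<\epsilon\le\epsilon_0$ and any $n$ and $d<n/2$, the following holds: there is a DAG $\mathcal{S}$ on $n$ nodes with maximum in-degree at most $d$ such that any algorithm that is given $\mathcal{S}$ and sample access to an unknown Bayes net $P$ over $\{0,1\}^n$ with structure $\mathcal{S}$, and distinguishes (with probability at least $2/3$) between the cases $P=U$ and $\|P-U\|_1>\epsilon$, requires $\Omega(2^{d/2}n^{1/2}/\epsilon^2)$ samples. Here $U$ is the uniform distribution on $\{0,1\}^n$.
   Context: A distribution $P$ on $\{0,1\}^n$ is a Bayes net with structure $\mathcal{S}$ (a DAG on $[n]$, topologically sorted) if for each $i$, $\Pr_{X\sim P}[X_i=1\mid X_1,\dots,X_{i-1}]$ depends only on the coordinates at the parents of $i$ in $\mathcal{S}$. $\|P-Q\|_1=\sum_x|P(x)-Q(x)|$. Testers must succeed (accept if $P=U$, reject if $\|P-U\|_1>\epsilon$) with probability at least $2/3$. *)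

(* Defs.v *)
From HB Require Import structures.
From mathcomp Require Import all_boot all_order all_algebra.
From mathcomp Require Import all_classical all_reals all_analysis.

Set Implicit Arguments.
Unset Strict Implicit.
Unset Printing Implicit Defensive.

Import Order.TTheory GRing.Theory Num.Theory.

Local Open Scope ring_scope.

Definition cube (n : nat) := {ffun 'I_n -> bool}.

Record distr (R : realType) (T : finType) := Distr {
  pmf :> T -> R;
  pmf_ge0 : forall x, 0 <= pmf x;
  pmf_sum1 : \sum_(x : T) pmf x = 1
}.

Definition prob (R : realType) (T : finType) (P : distr R T) (A : pred T) : R :=
  \sum_(x | A x) P x.

(* Only meaningful when [prob P B != 0]. *)
Definition cond_prob (R : realType) (T : finType) (P : distr R T)
    (A B : pred T) : R :=
  prob P (predI A B) / prob P B.

Definition l1_dist (R : realType) (T : finType) (P Q : distr R T) : R :=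
  \sum_(x : T) `|P x - Q x|.

Lemma uniform_pmf_ge0 (R : realType) (n : nat) (x : cube n) :
  0 <= (2 ^+ n)^-1 :> R.
Proof. by rewrite invr_ge0 exprn_ge0. Qed.

Lemma uniform_pmf_sum1 (R : realType) (n : nat) :
  \sum_(x : cube n) (2 ^+ n)^-1 = 1 :> R.
Proof.
rewrite sumr_const card_ffun card_bool card_ord -[LHS]mulr_natl natrX divff //.
Qed.

Definition uniform (R : realType) (n : nat) : distr R (cube n) :=
  Distr (@uniform_pmf_ge0 R n) (@uniform_pmf_sum1 R n).

(* The nodes are topologically sorted, which makes the graph acyclic. *)
Record dag (n : nat) := Dag {
  parents : 'I_n -> {set 'I_n};
  parents_lt : forall i j, j \in parents i -> (j < i)%N
}.

Definition max_indegree (n : nat) (S : dag n) : nat :=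
  (\max_(i < n) #|parents S i|)%N.

(* The event [X_j = x_j for all j < i]. *)
Definition same_prefix (n : nat) (i : 'I_n) (x : cube n) : pred (cube n) :=
  fun y => [forall j : 'I_n, (j < i)%N ==> (y j == x j)].

(* Conditional probabilities are compared only for prefixes of nonzero
   probability, where they are defined. *)
Definition bayes_net (R : realType) (n : nat) (S : dag n)
    (P : distr R (cube n)) : Prop :=
  forall (i : 'I_n) (x y : cube n),
    prob P (same_prefix i x) != 0 -> prob P (same_prefix i y) != 0 ->
    (forall j, j \in parents S i -> x j = y j) ->
    cond_prob P (fun z => z i) (same_prefix i x) =
    cond_prob P (fun z => z i) (same_prefix i y).

(* A randomized algorithm using [m] samples, given by its acceptance
   probability on each possible sequence of samples. *)
Record tester (R : realType) (n m : nat) := Tester {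
  accept :> {ffun 'I_m -> cube n} -> R;
  accept_ge0 : forall s, 0 <= accept s;
  accept_le1 : forall s, accept s <= 1
}.

Definition accept_prob (R : realType) (n m : nat) (A : tester R n m)
    (P : distr R (cube n)) : R :=
  \sum_(s : {ffun 'I_m -> cube n}) (\prod_(k < m) P (s k)) * A s.

Definition reject_prob (R : realType) (n m : nat) (A : tester R n m)
    (P : distr R (cube n)) : R :=
  \sum_(s : {ffun 'I_m -> cube n}) (\prod_(k < m) P (s k)) * (1 - A s).

Definition tests_uniformity (R : realType) (n m : nat) (S : dag n) (eps : R)
    (A : tester R n m) : Prop :=
  forall P : distr R (cube n), bayes_net S P ->
    (P =1 uniform R n -> 2 / 3 <= accept_prob A P) /\
    (l1_dist P (uniform R n) > eps -> 2 / 3 <= reject_prob A P).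

(* Main.v *)
Require Import Defs.
From HB Require Import structures.
From mathcomp Require Import all_boot all_order all_algebra.
From mathcomp Require Import all_classical all_reals all_analysis.
From mathcomp Require Import ring lra.

(** Write n = d + N. In the hard instances the first d bits are uniform and are
    the parents of the N others, which given the prefix a are independent with
    biases +-x, the signs z(a, i) being arbitrary and x = 23 eps / sqrt N. Every
    choice of z gives a distribution at the same L1 distance from uniform, and
    comparing the second and fourth moments of the likelihood ratio shows that
    this distance exceeds eps. For random z, one plus the chi-square divergence
    of the m-sample mixture from uniform is the mean of
    (2^-d sum_a prod_i (1 + x^2 z(a,i) z'(a,i)))^m. Bounding this power by an
    exponential decouples the prefixes a, and a bounded-difference argument over
    i bounds the mean by exp(8 m^2 x^4 N / 2^d). A tester needs this to be at
    least 10/9, that is m of order 2^(d/2) sqrt N / eps^2. *)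

Set Implicit Arguments.
Unset Strict Implicit.
Unset Printing Implicit Defensive.

Import Order.TTheory GRing.Theory Num.Theory.

Local Open Scope ring_scope.

(** * Elementary bounds for powers and exponentials *)

Lemma bernoulli_ge (R : realType) (x : R) (N : nat) :
  0 <= x -> 1 + N%:R * x <= (1 + x) ^+ N.
Proof.
move=> x0; elim: N => [|N IH]; first by rewrite expr0 mul0r addr0.
rewrite exprS; apply: (@le_trans _ _ ((1 + x) * (1 + N%:R * x))).
  rewrite -natr1; have : 0 <= N%:R * (x * x) by rewrite !mulr_ge0.
  by nra.
by rewrite ler_wpM2l // addr_ge0.
Qed.

(** Induction on [N]: with [u = N x], the step leaves a slack of [x u + x ^ 2 - x u ^ 2], which is
    nonnegative because [u <= 1]. *)
Lemma bernoulli_le (R : realType) (x : R) (N : nat) :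
  0 <= x -> N%:R * x <= 1 -> (1 + x) ^+ N <= 1 + N%:R * x + (N%:R * x) ^+ 2.
Proof.
move=> x0; elim: N => [|N IH] Nx1.
  by rewrite expr0 !mul0r !addr0 expr0n /= addr0.
have Nx : N%:R * x <= 1.
  by apply: le_trans Nx1; rewrite ler_wpM2r // ler_nat.
rewrite exprS; apply: (le_trans (ler_wpM2l _ (IH Nx))); first by rewrite addr_ge0.
rewrite -natr1; set u := N%:R * x; have u0 : 0 <= u by rewrite mulr_ge0.
have -> : (N%:R + 1) * x = u + x by rewrite mulrDl mul1r.
have : x * u * u <= x * u * 1 by rewrite ler_wpM2l ?mulr_ge0.
have : 0 <= x * u by rewrite mulr_ge0.
by move: (sqr_ge0 x); nra.
Qed.

(** From [1 - x <= expR (- x)] one gets [expR x * (1 - x) <= 1], and the quadratic dominates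
    [1 / (1 - x)] up to [1 / 2], for negative [x] as well. *)
Lemma expR_le_quad (R : realType) (x : R) :
  x <= 1 / 2 -> expR x <= 1 + x + 2 * x ^+ 2.
Proof.
move=> xh; have e0 := expR_gt0 x.
have h : expR x * (1 - x) <= 1.
  rewrite -[leRHS](divff (lt0r_neq0 e0)) -expRN ler_wpM2l ?(ltW e0) //.
  exact: expR_ge1Dx.
have h2 : 1 <= (1 + x + 2 * x ^+ 2) * (1 - x).
  have -> : (1 + x + 2 * x ^+ 2) * (1 - x) = 1 + x ^+ 2 * (1 - 2 * x) by ring.
  by rewrite lerDl mulr_ge0 ?sqr_ge0 //; lra.
have := le_trans h h2; rewrite ler_pM2r //; lra.
Qed.

(** For [|x| <= 1 / 2] the linear terms of the two quadratic bounds cancel; beyond that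
    [|x| <= 2 x ^ 2], so each exponential is small enough by itself. *)
Lemma cosh_le_expR (R : realType) (x : R) :
  expR x + expR (- x) <= 2 * expR (2 * x ^+ 2).
Proof.
have [xh|xh] := lerP `|x| (1 / 2).
  move: xh; rewrite ler_norml => /andP[h1 h2].
  have := expR_le_quad h2; have nx : - x <= 1 / 2 by lra.
  have := expR_le_quad nx; have := expR_ge1Dx (2 * x ^+ 2).
  by rewrite sqrrN; lra.
have hx : `|x| <= 2 * x ^+ 2.
  by rewrite -real_normK ?num_real // expr2; nra.
have : expR x <= expR (2 * x ^+ 2).
  by rewrite ler_expR (le_trans _ hx) // ler_norm.
have : expR (- x) <= expR (2 * x ^+ 2).
  by rewrite ler_expR (le_trans _ hx) // -normrN ler_norm.
by lra.
Qed.

(** * Tilted product distributions: exponential moments and L1 distance *)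

Definition bsign (R : realType) (b : bool) : R := if b then 1 else -1.

(** The likelihood ratio, against uniform, of the product distribution whose bit [i] equals [b i]
    with probability [(1 + x) / 2]. It is symmetric in [b] and [y]. *)
Definition tilt (R : realType) (N : nat) (x : R) (b y : cube N) : R :=
  \prod_i (1 + x * (bsign R (b i) * bsign R (y i))).

Definition flip (n : nat) (i : 'I_n) (x : cube n) : cube n :=
  [ffun j => if j == i then ~~ x j else x j].

Lemma flipK (n : nat) (i : 'I_n) : involutive (flip i).
Proof. by move=> x; apply/ffunP => j; rewrite !ffunE; case: eqP => // _; rewrite negbK. Qed.

Lemma sum_flip (R : realType) (n : nat) (i : 'I_n) (F : cube n -> R) :
  2 * \sum_x F x = \sum_x (F x + F (flip i x)).
Proof.
rewrite big_split /= mulr_natl mulr2n; congr (_ + _).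
exact: (reindex_inj (inv_inj (flipK i))).
Qed.

Lemma sum_cube_prod (R : realType) (n : nat) (g : 'I_n -> bool -> R) :
  \sum_(y : cube n) \prod_i g i (y i) = \prod_i (g i true + g i false).
Proof.
rewrite -(bigA_distr_bigA g).
by apply: eq_bigr => i _; rewrite big_bool.
Qed.

(* Azuma's argument: exposing one coordinate multiplies the partial product
   [L <= 2] by [1 +- x], which costs a factor [cosh (t x L)] in the mean. *)
Lemma sum_expR_tilt_le (R : realType) (N : nat) (b : cube N) (x t : R) :
  0 <= x <= 1 -> (1 + x) ^+ N <= 2 ->
  \sum_(y : cube N)
    expR (t * (tilt x b y - 1))
  <= 2 ^+ N * expR (8 * (t * x) ^+ 2 * N%:R).
Proof.
move=> /andP[x0 x1] hx.
pose f (y : cube N) i : R := 1 + x * (bsign R (b i) * bsign R (y i)).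
have f0 y i : 0 <= f y i.
  by rewrite /f /bsign; case: (b i); case: (y i); lra.
have f1 y i : f y i <= 1 + x.
  by rewrite /f /bsign; case: (b i); case: (y i); lra.
pose L j y := \prod_(i : 'I_N | (i < j)%N) f y i.
have L0 j y : 0 <= L j y by apply: prodr_ge0.
have L2 j y : L j y <= 2.
  apply: le_trans hx; rewrite /L.
  have -> : (1 + x) ^+ N = \prod_(i < N) (1 + x) by rewrite prodr_const card_ord.
  rewrite big_mkcond /=; apply: ler_prod => i _.
  case: ifP => _; rewrite ?f0 ?f1 ?ler01 //=; lra.
have main j : (j <= N)%N ->
    \sum_y expR (t * (L j y - 1)) <= 2 ^+ N * expR (8 * (t * x) ^+ 2 * j%:R).
  elim: j => [_|j IH jN].
    rewrite mulr0 expR0 mulr1 (eq_bigr (fun=> 1)); last first.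
      by move=> y _; rewrite /L big_pred0 // subrr mulr0 expR0.
    by rewrite sumr_const card_ffun card_bool card_ord natrX.
  pose k := Ordinal jN.
  have LS y : L j.+1 y = L j y * f y k.
    rewrite /L (bigD1 k) /=; last by rewrite ltnS.
    rewrite mulrC; congr (_ * _); apply: eq_bigl => i.
    by rewrite ltnS -val_eqE /= ltn_neqAle andbC.
  have Lflip y : L j (flip k y) = L j y.
    apply: eq_bigr => i ij; rewrite /f ffunE.
    by rewrite -val_eqE /= ltn_eqF.
  have fk y : exists2 s : R, f y k = 1 + x * s &
      f (flip k y) k = 1 - x * s /\ s ^+ 2 = 1.
    exists (bsign R (b k) * bsign R (y k)) => //; rewrite /f ffunE eqxx /bsign.
    by case: (b k); case: (y k) => /=; split; ring.
  rewrite -(ler_pM2l (_ : 0 < 2 :> R)) // (sum_flip k).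
  apply: (@le_trans _ _ (\sum_y (2 * expR (8 * (t * x) ^+ 2)) *
                               expR (t * (L j y - 1)))).
    apply: ler_sum => y _; rewrite !LS Lflip.
    have [s -> [-> s1]] := fk y; set l := L j y.
    have -> : t * (l * (1 + x * s) - 1) = t * (l - 1) + t * l * x * s by ring.
    have -> : t * (l * (1 - x * s) - 1) = t * (l - 1) + - (t * l * x * s) by ring.
    rewrite !expRD -mulrDr mulrC ler_wpM2r ?expR_ge0 //.
    (* The exponent is [2 (t l x) ^ 2], and [l <= 2] turns it into the [8 (t x) ^ 2] of the
       statement. *)
    apply: le_trans (cosh_le_expR _) _.
    rewrite ler_wpM2l // ler_expR.
    have -> : 2 * (t * l * x * s) ^+ 2 = 2 * (t * x) ^+ 2 * (l ^+ 2 * s ^+ 2) by ring.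
    have -> : 8 * (t * x) ^+ 2 = 2 * (t * x) ^+ 2 * 4 by ring.
    rewrite s1 mulr1 ler_wpM2l //; first by apply: mulr_ge0 => //; exact: sqr_ge0.
    have -> : 4 = 2 ^+ 2 :> R by ring.
    by rewrite ler_sqr ?nnegrE ?L0 ?L2.
  rewrite -mulr_sumr -mulrA ler_wpM2l //.
  apply: le_trans (ler_wpM2l (expR_ge0 _) (IH (ltnW jN))) _.
  rewrite mulrCA -expRD ler_wpM2l ?exprn_ge0 // ler_expR -natr1; lra.
have LN y : L N y = tilt x b y by apply: eq_bigl => i; rewrite ltn_ord.
have := main N (leqnn N).
by under eq_bigr => y _ do rewrite LN.
Qed.

(** The coordinates factor, and the sign [b i] only swaps the two terms of its factor, so no moment
    depends on [b]. *)
Lemma sum_tilt_exp (R : realType) (N k : nat) (b : cube N) (x : R) :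
  \sum_(y : cube N) tilt x b y ^+ k
  = ((1 + x) ^+ k + (1 - x) ^+ k) ^+ N.
Proof.
under eq_bigr => y _ do rewrite /tilt -prodrXl.
rewrite (sum_cube_prod (fun i c => (1 + x * (bsign R (b i) * bsign R c)) ^+ k)).
have -> : ((1 + x) ^+ k + (1 - x) ^+ k) ^+ N =
    \prod_(i < N) ((1 + x) ^+ k + (1 - x) ^+ k) by rewrite prodr_const card_ord.
apply: eq_bigr => i _; rewrite /bsign; case: (b i); rewrite ?mulN1r ?mul1r ?opprK //.
  by rewrite mulr1 mulrN1.
by rewrite mulr1 mulrN1 addrC.
Qed.

(* Comparison of second and fourth moments, through
   [F ^ 2 <= a |F| + F ^ 4 / a ^ 2] with [a = 11 u]. *)
Lemma sum_tilt_dist_ge (R : realType) (N : nat) (b : cube N) (x u : R) :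
  0 < u -> N%:R * x ^+ 2 = u ^+ 2 -> 7 * u ^+ 2 <= 1 ->
  2 ^+ N * (u / 22) <=
  \sum_(y : cube N) `|tilt x b y - 1|.
Proof.
move=> u0 hN hu.
pose G (y : cube N) : R := tilt x b y.
pose E (F : cube N -> R) := (2 ^+ N)^-1 * \sum_y F y.
have p2 : 0 < 2 ^+ N :> R by rewrite exprn_gt0.
have N0 : (0 < N)%N.
  case: N {b G E p2} hN => // /esym/eqP; rewrite mul0r sqrf_eq0; lra.
have N1 : 1 <= N%:R :> R by rewrite ler1n.
have EG k : E (fun y => G y ^+ k) = (((1 + x) ^+ k + (1 - x) ^+ k) / 2) ^+ N.
  by rewrite /E /G sum_tilt_exp exprMn exprVn mulrC.
have E1 : E (fun=> 1) = 1.
  by rewrite /E sumr_const card_ffun card_bool card_ord natrX mulVf ?lt0r_neq0.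
have ED F1 F2 : E (fun y => F1 y + F2 y) = E F1 + E F2.
  by rewrite /E big_split mulrDr.
have EZ c F : E (fun y => c * F y) = c * E F.
  by rewrite /E -mulr_sumr mulrCA.
have ele F1 F2 : (forall y, F1 y <= F2 y) -> E F1 <= E F2.
  by move=> h; rewrite /E ler_wpM2l ?invr_ge0 ?(ltW p2) // ler_sum.
have M1 : E (fun y => G y ^+ 1) = 1.
  by rewrite EG !expr1 [X in X ^+ N](_ : _ = 1) ?expr1n //; field.
have M2 : E (fun y => G y ^+ 2) = (1 + x ^+ 2) ^+ N.
  by rewrite EG; congr (_ ^+ N); field.
have M3 : E (fun y => G y ^+ 3) = (1 + 3 * x ^+ 2) ^+ N.
  by rewrite EG; congr (_ ^+ N); field.
have M4 : E (fun y => G y ^+ 4) = (1 + (6 * x ^+ 2 + x ^+ 4)) ^+ N.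
  by rewrite EG; congr (_ ^+ N); field.
have F2 : E (fun y => (G y - 1) ^+ 2) = (1 + x ^+ 2) ^+ N - 1.
  transitivity (E (fun y => G y ^+ 2 + ((-2) * G y ^+ 1 + 1))).
    by congr E; apply/funext => y; ring.
  by rewrite !ED EZ M2 M1 E1; ring.
have F4 : E (fun y => (G y - 1) ^+ 4) = (1 + (6 * x ^+ 2 + x ^+ 4)) ^+ N
    - 4 * (1 + 3 * x ^+ 2) ^+ N + 6 * (1 + x ^+ 2) ^+ N - 3.
  transitivity (E (fun y => G y ^+ 4 + ((-4) * G y ^+ 3 +
                   (6 * G y ^+ 2 + ((-4) * G y ^+ 1 + 1))))).
    by congr E; apply/funext => y; ring.
  by rewrite !ED !EZ M4 M3 M2 M1 E1; ring.
set q := x ^+ 2 in hN M2 M3 M4 F2 F4.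
have x4 : x ^+ 4 = q ^+ 2 by rewrite -exprM.
have q0 : 0 <= q by exact: sqr_ge0.
rewrite x4 in F4.
set v := u ^+ 2 in hN hu.
have v0 : 0 < v by rewrite exprn_gt0.
have qv : q <= v by rewrite -hN ler_peMl.
have Nq2 : N%:R * q ^+ 2 <= v ^+ 2.
  by rewrite expr2 mulrA hN expr2 ler_wpM2l // ltW.
have Nq2' : 0 <= N%:R * q ^+ 2 by rewrite mulr_ge0 // sqr_ge0.
have vv : v ^+ 2 <= v by rewrite expr2; nra.
have F2ge : v <= E (fun y => (G y - 1) ^+ 2).
  by rewrite F2; have := bernoulli_ge N q0; rewrite hN; lra.
(* The constant and linear terms in [v] cancel. What remains is [49 v ^ 2] from the fourth moment,
   [6 v ^ 2] from the second, and [N q ^ 2 <= v ^ 2]: in all 56. The assumption [7 v <= 1] is what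
   [bernoulli_le] needs for the fourth moment. *)
have F4le : E (fun y => (G y - 1) ^+ 4) <= 56 * v ^+ 2.
  rewrite F4.
  have h3 : 1 + 3 * v <= (1 + 3 * q) ^+ N.
    have := @bernoulli_ge _ (3 * q) N _; rewrite (mulrCA N%:R) hN; apply; lra.
  have h2 : (1 + q) ^+ N <= 1 + v + v ^+ 2.
    by have := @bernoulli_le _ q N q0; rewrite hN; apply; lra.
  have eqN : N%:R * (6 * q + q ^+ 2) = 6 * v + N%:R * q ^+ 2.
    by rewrite mulrDr (mulrCA N%:R) hN.
  have h4 : (1 + (6 * q + q ^+ 2)) ^+ N <= 1 + (6 * v + N%:R * q ^+ 2) + (7 * v) ^+ 2.
    have := @bernoulli_le _ (6 * q + q ^+ 2) N _ _.
    rewrite eqN => h; apply: le_trans (h _ _) _; [by have := sqr_ge0 q; lra|lra|].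
    by rewrite lerD2l ler_sqr ?nnegrE; lra.
  have h7 : (7 * v) ^+ 2 = 49 * v ^+ 2 by ring.
  by lra.
pose a := 11 * u.
have a0 : 0 < a by rewrite /a; lra.
have key : E (fun y => (G y - 1) ^+ 2) <=
    a * E (fun y => `|G y - 1|) + (a ^+ 2)^-1 * E (fun y => (G y - 1) ^+ 4).
  rewrite -!EZ -ED; apply: ele => y; set w := G y - 1.
  have -> : w ^+ 4 = (`|w| ^+ 2) ^+ 2 by rewrite real_normK ?num_real // -exprM.
  rewrite -[w ^+ 2]real_normK ?num_real //; move: (`|w|) (normr_ge0 w) => {w}w w0.
  have [wa|wa] := lerP w a.
    apply: (@le_trans _ _ (a * w)); first by rewrite expr2 ler_wpM2r.
    by rewrite lerDl mulr_ge0 ?invr_ge0 ?sqr_ge0.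
  apply: (@le_trans _ _ ((a ^+ 2)^-1 * (w ^+ 2) ^+ 2)); last first.
    by rewrite lerDr mulr_ge0 // ltW.
  rewrite [leRHS]mulrC ler_pdivlMr ?exprn_gt0 // [leRHS]expr2 ler_wpM2l ?sqr_ge0 //.
  by rewrite ler_sqr ?nnegrE // ltW.
(* The choice [a = 11 u] makes [a ^ 2 = 121 v], more than twice [56 v], so the fourth moment absorbs
   at most half of [v]. *)
have fin : v <= a * E (fun y => `|G y - 1|) + v / 2.
  apply: le_trans F2ge (le_trans key _); rewrite lerD2l.
  rewrite mulrC ler_pdivrMr ?exprn_gt0 //; apply: le_trans F4le _.
  have -> : a ^+ 2 = 121 * v by rewrite /a /v; ring.
  by have := sqr_ge0 v; rewrite expr2; lra.
have {fin}: u * (u / 22) <= u * E (fun y => `|G y - 1|).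
  by move: fin; rewrite /v /a expr2; lra.
by rewrite ler_pM2l // /E [leRHS]mulrC ler_pdivlMr // mulrC.
Qed.

(** * Bayes nets built from conditional probabilities *)

Definition upd (n : nat) (k : 'I_n) (b : bool) (x : cube n) : cube n :=
  [ffun j => if j == k then b else x j].

(** Here [q i x] stands for the conditional probability that bit [i] is one. It takes a whole point
    of the cube; [respects] separately restricts it to the parents. *)
Definition bn_factor (R : realType) (n : nat) (q : 'I_n -> cube n -> R)
    (i : 'I_n) (x : cube n) : R :=
  if x i then q i x else 1 - q i x.

Definition bn_pmf (R : realType) (n : nat) (q : 'I_n -> cube n -> R)
    (x : cube n) : R :=
  \prod_i bn_factor q i x.

Definition respects (R : realType) (n : nat) (S : dag n)
    (q : 'I_n -> cube n -> R) : Prop :=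
  forall i (x y : cube n), (forall j, j \in parents S i -> x j = y j) -> q i x = q i y.

(** Splitting a prefix event on its next bit gives events of the same shape, which keeps the
    induction on prefixes going. *)
Lemma prefix_upd (n : nat) (k : 'I_n) (b : bool) (x y : cube n) :
  [forall j : 'I_n, (j < k)%N ==> (y j == x j)] && (y k == b) =
  [forall j : 'I_n, (j < k.+1)%N ==> (y j == upd k b x j)].
Proof.
apply/andP/forallP => [[/forallP h /eqP yk] j|h].
  rewrite ffunE ltnS leq_eqVlt -val_eqE /=.
  by case: eqP => [/val_inj ->|_] /=; [rewrite yk|exact: h].
split; last by have := h k; rewrite ltnS leqnn ffunE eqxx.
apply/forallP => j; apply/implyP => jk; have := h j.
by rewrite ltnS (ltnW jk) ffunE -val_eqE /= ltn_eqF.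
Qed.

Lemma bn_prefix_upd (R : realType) (n : nat) (S : dag n)
    (q : 'I_n -> cube n -> R) (k : 'I_n) (b : bool) (x : cube n) :
  respects S q ->
  \prod_(i < n | (i < k.+1)%N) bn_factor q i (upd k b x) =
  (if b then q k x else 1 - q k x) * \prod_(i < n | (i < k)%N) bn_factor q i x.
Proof.
move=> qS; have qupd (i : 'I_n) : (i <= k)%N -> q i (upd k b x) = q i x.
  move=> ik; apply: qS => j /parents_lt ji; rewrite ffunE -val_eqE /=.
  by rewrite ltn_eqF // (leq_trans ji).
rewrite (bigD1 k) /=; last by rewrite ltnS.
rewrite {1}/bn_factor ffunE eqxx qupd //; congr (_ * _).
apply: eq_big => [i|i /andP[ik iNk]].
  by rewrite ltnS -val_eqE /= ltn_neqAle andbC.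
by rewrite /bn_factor ffunE (negbTE iNk) qupd.
Qed.

(** Downward induction from [k = n], where only [x] is left: splitting on bit [k] produces the
    weights [q] and [1 - q], which add up to one. The case [k = 0] is normalization. *)
Lemma bn_prefix_sum (R : realType) (n : nat) (S : dag n)
    (q : 'I_n -> cube n -> R) (k : nat) (x : cube n) :
  respects S q -> (k <= n)%N ->
  \sum_(y : cube n | [forall j : 'I_n, (j < k)%N ==> (y j == x j)]) bn_pmf q y
  = \prod_(i < n | (i < k)%N) bn_factor q i x.
Proof.
move=> qS; move hr : (n - k)%N => r; elim: r k x hr => [|r IH] k x hr kn.
  have {}kn : k = n by apply/eqP; rewrite eqn_leq kn -subn_eq0 hr.
  rewrite (big_pred1 x) => [|y] /=.
    by apply: eq_bigl => i; rewrite kn ltn_ord.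
  apply/forallP/eqP => [h|-> j]; last by rewrite eqxx implybT.
  by apply/ffunP => j; have := h j; rewrite kn ltn_ord => /eqP.
have kn' : (k < n)%N by rewrite -subn_gt0 hr.
pose K := Ordinal kn'.
have step b : \sum_(y : cube n | [forall j : 'I_n, (j < k)%N ==> (y j == x j)]
                                 && (y K == b)) bn_pmf q y
    = (if b then q K x else 1 - q K x) * \prod_(i < n | (i < k)%N) bn_factor q i x.
  rewrite (eq_bigl _ _ (prefix_upd K b x)) IH //; last by rewrite subnS hr.
  exact: bn_prefix_upd qS.
rewrite (bigID (fun y : cube n => y K == true)) /= (step true).
rewrite (eq_bigl (fun y : cube n => [forall j : 'I_n, (j < k)%N ==> (y j == x j)]
    && (y K == false))); last by move=> y; case: (y K).
by rewrite step -mulrDl addrC subrK mul1r.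
Qed.

Lemma bn_factor_ge0 (R : realType) (n : nat) (q : 'I_n -> cube n -> R) i x :
  (forall i x, 0 <= q i x <= 1) -> 0 <= bn_factor q i x.
Proof. by move=> /(_ i x)/andP[? ?]; rewrite /bn_factor; case: ifP; lra. Qed.

Lemma bn_pmf_ge0 (R : realType) (n : nat) (q : 'I_n -> cube n -> R) :
  (forall i x, 0 <= q i x <= 1) -> forall x, 0 <= bn_pmf q x.
Proof. by move=> q01 x; apply: prodr_ge0 => i _; exact: bn_factor_ge0. Qed.

Lemma bn_pmf_sum1 (R : realType) (n : nat) (S : dag n) (q : 'I_n -> cube n -> R) :
  respects S q -> \sum_x bn_pmf q x = 1.
Proof.
move=> qS; have := bn_prefix_sum [ffun=> true] qS (leq0n n).
rewrite [RHS]big_pred0 // => <-; apply: eq_bigl => y.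
by apply/esym/forallP => j.
Qed.

Definition bn_distr (R : realType) (n : nat) (S : dag n)
    (q : 'I_n -> cube n -> R) (q01 : forall i x, 0 <= q i x <= 1)
    (qS : respects S q) : distr R (cube n) :=
  Distr (bn_pmf_ge0 q01) (bn_pmf_sum1 qS).

(** The quotient of two consecutive prefix probabilities is [q i x], which depends on the parents
    alone. *)
Lemma bn_distr_bayes_net (R : realType) (n : nat) (S : dag n)
    (q : 'I_n -> cube n -> R) (q01 : forall i x, 0 <= q i x <= 1)
    (qS : respects S q) :
  bayes_net S (bn_distr q01 qS).
Proof.
have cond (i : 'I_n) (x : cube n) :
    prob (bn_distr q01 qS) (Defs.same_prefix i x) != 0 ->
    cond_prob (bn_distr q01 qS) (fun z => z i) (Defs.same_prefix i x) = q i x.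
  rewrite /cond_prob /prob /Defs.same_prefix /=.
  rewrite (bn_prefix_sum x qS (ltnW (ltn_ord i))) => p0.
  apply/(canLR (mulfK p0)).
  rewrite -(bn_prefix_upd i true x qS) -(bn_prefix_sum _ qS (ltn_ord i)).
  by apply: eq_bigl => y; rewrite /= -prefix_upd eqb_id andbC.
by move=> i x y px py /qS xy; rewrite !cond.
Qed.

(** * Le Cam's method for several samples *)

Lemma sum_prod_samples (R : realType) (T : finType) (m : nat) (f : T -> R) :
  \sum_(s : {ffun 'I_m -> T}) \prod_(k < m) f (s k) = (\sum_x f x) ^+ m.
Proof.
rewrite -(bigA_distr_bigA (fun (_ : 'I_m) x => f x)).
by rewrite prodr_const card_ord.
Qed.

(* Le Cam's method: divided by [#|Z| ^ 2], the right-hand side is one plus the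
   chi-square divergence of the uniform mixture of the [P z] from [U], over [m]
   samples. *)
Lemma le_cam_chi2 (R : realType) (n m : nat) (Z : finType) (A : tester R n m)
    (U : distr R (cube n)) (P : Z -> distr R (cube n)) (D : Z -> cube n -> R) :
  (0 < #|Z|)%N -> (forall z x, P z x = U x * D z x) ->
  2 / 3 <= accept_prob A U -> (forall z, 2 / 3 <= reject_prob A (P z)) ->
  10 / 9 * #|Z|%:R ^+ 2 <=
  \sum_z \sum_z' (\sum_x U x * (D z x * D z' x)) ^+ m.
Proof.
move=> Z0 PD accU rejP.
have z0 : 0 < #|Z|%:R :> R by rewrite ltr0n.
pose W (s : {ffun 'I_m -> cube n}) := \prod_(k < m) U (s k).
(* [Q z] is the likelihood ratio of the [m] samples under [P z], and [H] that of the mixture. *)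
pose Q z (s : {ffun 'I_m -> cube n}) := \prod_(k < m) D z (s k).
pose H s := (#|Z|%:R)^-1 * \sum_z Q z s.
have W0 s : 0 <= W s by apply: prodr_ge0 => k _; exact: Defs.pmf_ge0.
have W1 : \sum_s W s = 1 by rewrite sum_prod_samples Defs.pmf_sum1 expr1n.
have PW z (s : {ffun 'I_m -> cube n}) : \prod_(k < m) P z (s k) = W s * Q z s.
  by rewrite -big_split; apply: eq_bigr => k _; rewrite PD.
have WQ z : \sum_s W s * Q z s = 1.
  under eq_bigr => s _ do rewrite -PW.
  by rewrite sum_prod_samples Defs.pmf_sum1 expr1n.
have WH (B : {ffun 'I_m -> cube n} -> R) :
    \sum_s W s * H s * B s = (#|Z|%:R)^-1 * \sum_z \sum_s W s * Q z s * B s.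
  rewrite exchange_big mulr_sumr; apply: eq_bigr => s _.
  rewrite -mulr_suml -mulr_sumr /H; ring.
have avg (c : R) : (#|Z|%:R)^-1 * \sum_(z : Z) c = c.
  by rewrite sumr_const -[c *+ _]mulr_natl mulKf // lt0r_neq0.
have WH1 : \sum_s W s * H s = 1.
  under eq_bigr => s _ do rewrite -[W s * H s]mulr1.
  rewrite WH (eq_bigr (fun=> 1)) ?avg // => z _.
  by under eq_bigr => s _ do rewrite mulr1.
have WHA : \sum_s W s * H s * A s <= 1 / 3.
  rewrite WH -[leRHS]avg ler_wpM2l ?invr_ge0 ?(ltW z0) //; apply: ler_sum => z _.
  have := rejP z; rewrite /reject_prob.
  under eq_bigr => s _ do rewrite PW mulrBr mulr1.
  by rewrite big_split /= sumrN WQ; lra.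
have WA : 2 / 3 <= \sum_s W s * A s by exact: accU.
have WH2 : \sum_s W s * H s ^+ 2 =
    (#|Z|%:R ^+ 2)^-1 * \sum_z \sum_z' (\sum_x U x * (D z x * D z' x)) ^+ m.
  under eq_bigr => s _ do rewrite expr2 mulrA.
  rewrite WH expr2 invfM -mulrA; congr (_ * _); rewrite mulr_sumr.
  apply: eq_bigr => z _.
  transitivity ((#|Z|%:R)^-1 * \sum_s \sum_z' W s * Q z s * Q z' s).
    by rewrite mulr_sumr; apply: eq_bigr => s _; rewrite -mulr_sumr /H; ring.
  rewrite exchange_big /=; congr (_ * _); apply: eq_bigr => z' _.
  rewrite -sum_prod_samples; apply: eq_bigr => s _.
  by rewrite -!big_split; apply: eq_bigr => k _ /=; rewrite mulrA.
(* A weighted form of Cauchy-Schwarz: pointwise [A (1 - H) <= 3 / 2 (1 - H) ^ 2 + A ^ 2 / 6], with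
   [A ^ 2 <= 1]. The gap [1 / 3] in acceptance then forces the mean of [(1 - H) ^ 2] to be at least
   [1 / 9]. *)
have key : \sum_s W s * A s - \sum_s W s * H s * A s <=
    3 / 2 * (\sum_s W s - 2 * (\sum_s W s * H s) + \sum_s W s * H s ^+ 2)
    + 1 / 6 * \sum_s W s.
  rewrite !mulrDr !mulrN !mulr_sumr -!sumrN -!big_split /=; apply: ler_sum => s _.
  rewrite -subr_ge0.
  have A2 : 0 <= 1 - A s ^+ 2.
    by have := accept_ge0 A s; have := accept_le1 A s; nra.
  have -> : 3 / 2 * W s - 3 / 2 * (2 * (W s * H s)) + 3 / 2 * (W s * H s ^+ 2)
      + 1 / 6 * W s - (W s * A s - W s * H s * A s)
    = W s * (3 / 2 * (1 - H s - A s / 3) ^+ 2 + 1 / 6 * (1 - A s ^+ 2)) by field.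
  have := sqr_ge0 (1 - H s - A s / 3) => sq.
  by apply: mulr_ge0 => //; lra.
have : 10 / 9 <= \sum_s W s * H s ^+ 2 by rewrite W1 WH1 in key; lra.
by rewrite WH2 [leRHS]mulrC ler_pdivlMr ?exprn_gt0.
Qed.

(** * The hub graph and its hard instances *)

Definition head_bits (d N : nat) (x : cube (d + N)) : cube d :=
  [ffun i => x (lshift N i)].

Definition tail_bits (d N : nat) (x : cube (d + N)) : cube N :=
  [ffun i => x (rshift d i)].

Lemma sum_cube_split (R : realType) (d N : nat) (F : cube d -> cube N -> R) :
  \sum_(x : cube (d + N)) F (head_bits x) (tail_bits x) =
  \sum_(a : cube d) \sum_(y : cube N) F a y.
Proof.
rewrite pair_big /=; symmetry.
pose join (p : cube d * cube N) : cube (d + N) :=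
  [ffun i => match fintype.split i with inl j => p.1 j | inr j => p.2 j end].
rewrite (reindex (fun x : cube (d + N) => (head_bits x, tail_bits x))) //.
exists join => [x|[a y]] _.
  apply/ffunP => i; rewrite ffunE.
  by case: (split_ordP i) => j ->; rewrite ffunE.
congr pair; apply/ffunP => i; rewrite !ffunE.
  by rewrite (unsplitK (inl i)).
by rewrite (unsplitK (inr i)).
Qed.

Lemma hub_parents_lt (d N : nat) (i j : 'I_(d + N)) :
  j \in [set j : 'I_(d + N) | (j < d)%N && (d <= i)%N] -> (j < i)%N.
Proof. by rewrite inE => /andP[jd]; exact: leq_trans. Qed.

Definition hub_dag (d N : nat) : dag (d + N) := Dag (@hub_parents_lt d N).

Lemma hub_dag_indegree (d N : nat) : (max_indegree (hub_dag d N) <= d)%N.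
Proof.
apply/bigmax_leqP => i _ /=.
apply: (@leq_trans #|[set lshift N k | k : 'I_d]|); last first.
  by rewrite (leq_trans (leq_imset_card _ _)) // cardT size_enum_ord.
apply/subset_leq_card/fintype.subsetP => j; rewrite inE => /andP[jd _].
by apply/imsetP; exists (Ordinal jd) => //; exact/val_inj.
Qed.

Definition hub_cond (R : realType) (d N : nat) (x : R)
    (z : {ffun cube d -> cube N}) (i : 'I_(d + N)) (w : cube (d + N)) : R :=
  match fintype.split i with
  | inl _ => 1 / 2
  | inr k => (1 + x * bsign R (z (head_bits w) k)) / 2
  end.

Lemma hub_cond_itv (R : realType) (d N : nat) (x : R)
    (z : {ffun cube d -> cube N}) : 0 <= x <= 1 ->
  forall i w, 0 <= hub_cond x z i w <= 1.
Proof.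
move=> /andP[x0 x1] i w; rewrite /hub_cond; case: fintype.split => [_|k].
  by apply/andP; split; lra.
by rewrite /bsign; case: (z _ k); apply/andP; split; lra.
Qed.

Lemma hub_cond_respects (R : realType) (d N : nat) (x : R)
    (z : {ffun cube d -> cube N}) : respects (hub_dag d N) (hub_cond x z).
Proof.
move=> i v w vw; rewrite /hub_cond; case: (split_ordP i) vw => // k -> vw.
suff -> : head_bits v = head_bits w by [].
apply/ffunP => j; rewrite !ffunE; apply: vw.
by rewrite inE /= ltn_ord leq_addr.
Qed.

Lemma hub_pmfE (R : realType) (d N : nat) (x : R)
    (z : {ffun cube d -> cube N}) (w : cube (d + N)) :
  bn_pmf (hub_cond x z) w =
  uniform R (d + N) w * tilt x (z (head_bits w)) (tail_bits w).
Proof.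
rewrite /bn_pmf big_split_ord /= /uniform /= exprD invfM -mulrA; congr (_ * _).
  rewrite -exprVn -[d in RHS]card_ord -prodr_const; apply: eq_bigr => i _.
  by rewrite /bn_factor /hub_cond (unsplitK (inl i)); case: ifP => _; field.
rewrite -exprVn -[X in _ ^+ X]card_ord -prodr_const -big_split /=.
apply: eq_bigr => i _.
rewrite /bn_factor /hub_cond (unsplitK (inr i)) !ffunE /bsign.
by case: (w _); case: (z _ _); field.
Qed.

Definition hub_distr (R : realType) (d N : nat) (x : R) (x01 : 0 <= x <= 1)
    (z : {ffun cube d -> cube N}) : distr R (cube (d + N)) :=
  bn_distr (hub_cond_itv z x01) (@hub_cond_respects R d N x z).

Lemma hub_bayes_net (R : realType) (d N : nat) (x : R) (x01 : 0 <= x <= 1)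
    (z : {ffun cube d -> cube N}) :
  bayes_net (hub_dag d N) (hub_distr x01 z).
Proof. exact: bn_distr_bayes_net. Qed.

(** The distance is the mean over prefixes of the distances of the tilted tails, each at least
    [u / 22] whatever the signs, so every [z] is far and not only a typical one. *)
Lemma hub_l1_dist_ge (R : realType) (d N : nat) (x u : R) (x01 : 0 <= x <= 1)
    (z : {ffun cube d -> cube N}) :
  0 < u -> N%:R * x ^+ 2 = u ^+ 2 -> 7 * u ^+ 2 <= 1 ->
  u / 22 <= l1_dist (hub_distr x01 z) (uniform R (d + N)).
Proof.
move=> u0 hN hu; rewrite /l1_dist /=.
rewrite (eq_bigr (fun w : cube (d + N) => (2 ^+ (d + N))^-1 *
    `|tilt x (z (head_bits w)) (tail_bits w) - 1|)); last first.
  by move=> w _; rewrite hub_pmfE /= -[X in _ - X]mulr1 -mulrBr normrM ger0_norm.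
rewrite -mulr_sumr (sum_cube_split (fun a y => `|tilt x (z a) y - 1|)).
rewrite [leRHS]mulrC ler_pdivlMr ?exprn_gt0 //.
apply: (@le_trans _ _ (\sum_(a : cube d) 2 ^+ N * (u / 22))); last first.
  by apply: ler_sum => a _; exact: sum_tilt_dist_ge.
rewrite sumr_const card_ffun card_bool card_ord -[_ *+ (2 ^ d)]mulr_natl natrX exprD.
by rewrite mulrC -mulrA.
Qed.

(** Averaging over a tail bit kills the terms linear in [x], leaving [1 + x ^ 2] times the product
    of the two signs: again a tilt, now in the signs themselves. *)
Lemma hub_correlation (R : realType) (d N : nat) (x : R)
    (z z' : {ffun cube d -> cube N}) :
  \sum_w uniform R (d + N) w * (tilt x (z (head_bits w)) (tail_bits w) *
                               tilt x (z' (head_bits w)) (tail_bits w)) =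
  (2 ^+ d)^-1 * \sum_a tilt (x ^+ 2) (z' a) (z a).
Proof.
rewrite /= -mulr_sumr (sum_cube_split (fun a y => tilt x (z a) y * tilt x (z' a) y)).
rewrite exprD invfM -mulrA; congr (_ * _); rewrite mulr_sumr.
apply: eq_bigr => a _; rewrite /tilt.
rewrite (eq_bigr (fun y : cube N => \prod_i
    ((1 + x * (bsign R (z a i) * bsign R (y i))) *
     (1 + x * (bsign R (z' a i) * bsign R (y i)))))); last first.
  by move=> y _; rewrite big_split.
rewrite (sum_cube_prod (fun i c => (1 + x * (bsign R (z a i) * bsign R c)) *
                                   (1 + x * (bsign R (z' a i) * bsign R c)))).
rewrite -exprVn -[X in _ ^+ X]card_ord -prodr_const -big_split /=.
by apply: eq_bigr => i _; rewrite /bsign; case: (z a i); case: (z' a i); field.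
Qed.

(** The bound is uniform in [z'], so Le Cam's double sum can be handled one row at a time. *)
Lemma hub_chi2_le (R : realType) (d N m : nat) (x : R)
    (z' : {ffun cube d -> cube N}) :
  0 <= x <= 1 -> (1 + x ^+ 2) ^+ N <= 2 ->
  \sum_(z : {ffun cube d -> cube N})
    ((2 ^+ d)^-1 * \sum_a tilt (x ^+ 2) (z' a) (z a)) ^+ m
  <= #|{ffun cube d -> cube N}|%:R *
     expR (8 * m%:R ^+ 2 * x ^+ 4 * N%:R / 2 ^+ d).
Proof.
move=> /andP[x0 x1] hx; set q := x ^+ 2 in hx *.
have q01 : 0 <= q <= 1 by rewrite sqr_ge0 /q expr_le1.
have x4 : x ^+ 4 = q ^+ 2 by rewrite -exprM.
have p2 : 0 < 2 ^+ d :> R by rewrite exprn_gt0.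
have tilt0 (a b : cube N) : 0 <= tilt q a b.
  apply: prodr_ge0 => i _; move/andP: q01 => [? ?].
  by rewrite /bsign; case: (a i); case: (b i); lra.
have cardA : #|{: cube d}|%:R = 2 ^+ d :> R.
  by rewrite card_ffun card_bool card_ord natrX.
have cardZ : #|{: {ffun cube d -> cube N}}|%:R = (2 ^+ N) ^+ #|{: cube d}| :> R.
  rewrite [X in X%:R]card_ffun natrX; congr (_ ^+ _).
  by rewrite card_ffun card_bool card_ord natrX.
pose t : R := m%:R / 2 ^+ d.
apply: (@le_trans _ _ (\sum_(z : {ffun cube d -> cube N})
    \prod_a expR (t * (tilt q (z' a) (z a) - 1)))).
  apply: ler_sum => z _; set M := (2 ^+ d)^-1 * _.
  have -> : \prod_a expR (t * (tilt q (z' a) (z a) - 1)) = expR (M - 1) ^+ m.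
    rewrite -expRM_natl -expR_sum -mulr_sumr big_split /= sumrN sumr_const cardA.
    by congr expR; rewrite /t /M mulrBr mulrBr mulr1 mulrA divfK // lt0r_neq0.
  apply: lerXn2r; rewrite ?nnegrE ?expR_ge0 //.
    by rewrite mulr_ge0 ?invr_ge0 ?sumr_ge0 // ltW.
  by have := expR_ge1Dx (M - 1); rewrite addrCA subrr addr0.
(* The values [z a] are free for distinct [a], so the sum over [z] of the product factors over the
   prefixes. *)
rewrite -(bigA_distr_bigA (fun a y => expR (t * (tilt q (z' a) y - 1)))).
apply: (@le_trans _ _ (\prod_(a : cube d)
    (2 ^+ N * expR (8 * (t * q) ^+ 2 * N%:R)))).
  apply: ler_prod => a _; rewrite sumr_ge0 => [|y _]; last exact: expR_ge0.
  exact: sum_expR_tilt_le.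
rewrite prodr_const exprMn -expRM_natl cardA cardZ.
have -> : 2 ^+ d * (8 * (t * q) ^+ 2 * N%:R) =
    8 * m%:R ^+ 2 * x ^+ 4 * N%:R / 2 ^+ d.
  by rewrite x4 /t; field; rewrite lt0r_neq0.
by rewrite lexx.
Qed.

(** * Choice of parameters and the sample count *)

Theorem theorem5p12 (R : realType) :
  exists eps0 : R, 0 < eps0 /\
  exists c : R, 0 < c /\
  forall (eps : R) (n d : nat), 0 < eps -> eps <= eps0 -> (2 * d < n)%N ->
  exists S : dag n, (max_indegree S <= d)%N /\
  forall (m : nat) (A : tester R n m), tests_uniformity S eps A ->
    c * (2 `^ (d%:R / 2) * Num.sqrt n%:R / eps ^+ 2) <= m%:R.
Proof.
exists (1 / 100); split; first lra.
(* The condition is what the last comparison asks: [40 = 20 * 2], with 20 from [1 / 20 <= X] and 2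
   from [n <= 2 N]; the factor [8 * 23 ^ 4] comes from [X]. *)
have [c c0 c2] : exists2 c : R, 0 < c & c ^+ 2 * (40 * (8 * 23 ^+ 4)) <= 1.
  by exists (1 / 10000); lra.
exists c; split=> //.
move=> eps n d e0 e1 dn.
have [N nE] : exists N, n = (d + N)%N.
  by exists (n - d)%N; rewrite subnKC // (leq_trans _ (ltnW dn)) // leq_pmull.
subst n; have dN : (d < N)%N by move: dn; rewrite mul2n -addnn ltn_add2l.
exists (hub_dag d N); split; first exact: hub_dag_indegree.
move=> m A testA.
have N0 : 0 < N%:R :> R by rewrite ltr0n (leq_trans _ dN).
have N1 : 1 <= N%:R :> R by rewrite ler1n (leq_trans _ dN).
(* With 23 the distance bound [u / 22] exceeds [eps] strictly, and [eps <= 1 / 100] keeps [7 u ^ 2]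
   below 1. *)
pose u := 23 * eps; pose x := u / Num.sqrt N%:R.
have u0 : 0 < u by rewrite /u; lra.
have u2 : 7 * u ^+ 2 <= 1.
  have : eps ^+ 2 <= (1 / 100) ^+ 2 by rewrite ler_sqr ?nnegrE; lra.
  by rewrite /u exprMn; lra.
have xN : N%:R * x ^+ 2 = u ^+ 2.
  by rewrite /x expr_div_n sqr_sqrtr ?(ltW N0) // mulrC divfK // lt0r_neq0.
have x0 : 0 <= x by rewrite divr_ge0 ?sqrtr_ge0 // ltW.
have x2u : x ^+ 2 <= u ^+ 2 by rewrite -xN ler_peMl // sqr_ge0.
have x01 : 0 <= x <= 1.
  by rewrite x0 -(@expr_le1 _ 2) //; have := sqr_ge0 u; lra.
have far z : 2 / 3 <= reject_prob A (hub_distr x01 z).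
  have [_ rej] := testA _ (@hub_bayes_net _ _ _ _ x01 z).
  apply: rej; apply: lt_le_trans (hub_l1_dist_ge x01 z u0 xN u2).
  by rewrite /u; lra.
(* Bias zero exhibits the uniform distribution as a Bayes net on the hub graph, so the tester's
   guarantee applies to it. *)
have z00 : 0 <= (0 : R) <= 1 by rewrite lexx ler01.
have unif : hub_distr z00 [ffun=> [ffun=> true]] =1 uniform R (d + N).
  move=> w; rewrite /= hub_pmfE /tilt big1 ?mulr1 // => i _.
  by rewrite mul0r addr0.
have acc : 2 / 3 <= accept_prob A (uniform R (d + N)).
  have := (testA _ (@hub_bayes_net _ _ _ _ z00 _)).1 unif.
  rewrite /accept_prob (eq_bigr (fun s : {ffun 'I_m -> cube (d + N)} =>
      (\prod_(k < m) uniform R (d + N) (s k)) * A s)) //.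
  by move=> s _; congr (_ * _); apply: eq_bigr => k _; exact: unif.
have Z0 : (0 < #|{: {ffun cube d -> cube N}}|)%N.
  by apply/card_gt0P; exists [ffun=> [ffun=> true]].
have := le_cam_chi2 (P := hub_distr x01) (D := fun z w =>
  tilt x (z (head_bits w)) (tail_bits w)) Z0 (hub_pmfE x) acc far.
set X := 8 * m%:R ^+ 2 * x ^+ 4 * N%:R / 2 ^+ d.
have tilt2 : (1 + x ^+ 2) ^+ N <= 2.
  have xN1 : N%:R * x ^+ 2 <= 1 by rewrite xN; have := sqr_ge0 u; lra.
  apply: le_trans (bernoulli_le (sqr_ge0 x) xN1) _.
  by rewrite xN; have := sqr_ge0 u; nra.
move=> chi; have {chi} chi : 10 / 9 <= expR X.
  have z0 : 0 < #|{: {ffun cube d -> cube N}}|%:R ^+ 2 :> R.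
    by rewrite exprn_gt0 // ltr0n.
  rewrite -(ler_pM2r z0); apply: le_trans chi _.
  rewrite exchange_big /=.
  apply: (@le_trans _ _ (\sum_(z' : {ffun cube d -> cube N})
      #|{: {ffun cube d -> cube N}}|%:R * expR X)).
    apply: ler_sum => z' _; under eq_bigr => z _ do rewrite hub_correlation.
    exact: hub_chi2_le.
  by rewrite sumr_const -[_ *+ _]mulr_natl expr2 mulrA mulrC.
(* If [X < 1 / 20], the quadratic bound gives [expR X < 1.055], below [10 / 9]. *)
have {chi} Xge : 1 / 20 <= X.
  rewrite leNgt; apply/negP => X1.
  have X0 : 0 <= X.
    by rewrite /X divr_ge0 ?exprn_ge0 // !mulr_ge0 ?exprn_ge0 // ltW.
  have := @expR_le_quad R X; have : X ^+ 2 <= 1 / 20 * X.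
    by rewrite expr2 ler_wpM2r // ltW.
  by lra.
have p2 : 0 < 2 ^+ d :> R by rewrite exprn_gt0.
set B := _ / eps ^+ 2.
have B0 : 0 <= B.
  by rewrite /B divr_ge0 ?sqr_ge0 // mulr_ge0 ?powR_ge0 ?sqrtr_ge0.
(* The target bound [B] is compared with [m] through squares, which removes both square roots. *)
have B2 : B ^+ 2 * eps ^+ 4 = 2 ^+ d * (d + N)%:R.
  rewrite /B expr_div_n -exprM divfK; last by rewrite lt0r_neq0 // exprn_gt0.
  rewrite exprMn sqr_sqrtr // -powR_mulrn ?powR_ge0 // -powRrM divfK //.
  by rewrite powR_mulrn.
have XE : X * N%:R * 2 ^+ d = 8 * 23 ^+ 4 * m%:R ^+ 2 * eps ^+ 4.
  have -> : X * N%:R * 2 ^+ d = 8 * m%:R ^+ 2 * (N%:R * x ^+ 2) ^+ 2.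
    by rewrite /X; field; rewrite lt0r_neq0.
  by rewrite xN /u; ring.
(* Since [d < n / 2], the tail holds more than half of the nodes, so [N] may replace [n] up to a
   factor 2. *)
have nN : (d + N)%:R <= 2 * N%:R :> R.
  by rewrite -natrM ler_nat mul2n -addnn leq_add2r ltnW.
have e4 : 0 < eps ^+ 4 by rewrite exprn_gt0.
have mB : c ^+ 2 * (B ^+ 2 * eps ^+ 4) <= m%:R ^+ 2 * eps ^+ 4.
  set K := 8 * 23 ^+ 4 in XE c2.
  have l1 : 1 / 20 * (N%:R * 2 ^+ d) <= K * m%:R ^+ 2 * eps ^+ 4.
    by rewrite -XE -[leRHS]mulrA ler_pM2r // mulr_gt0.
  have l2 : 2 ^+ d * (d + N)%:R <= 2 * (N%:R * 2 ^+ d) :> R.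
    by rewrite mulrA [leRHS]mulrC ler_pM2l.
  have l3 : 0 <= m%:R ^+ 2 * eps ^+ 4 by rewrite mulr_ge0 ?sqr_ge0 // ltW.
  have l4 : B ^+ 2 * eps ^+ 4 <= 40 * K * (m%:R ^+ 2 * eps ^+ 4).
    by rewrite B2; lra.
  apply: le_trans (ler_wpM2l (sqr_ge0 c) l4) _.
  by rewrite [leLHS]mulrA ler_piMl.
move: mB; rewrite mulrA ler_pM2r // -exprMn ler_sqr ?nnegrE //.
by rewrite mulr_ge0 // ltW.
Qed.
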